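(* For the Invincible Fighter ($u=1$), property [B] holds: for every fixed $t\ge 0$, $K(n,t)$ is non-decreasing in $n$, $n=1,2,\dots$.
   Context: Fighter problem with discrete ammunition. Fix $u\in[0,1]$ and a sequence of probabilities $0=a(0)<a(1)<a(2)<\cdots$ (each $a(j)\in[0,1]$) that is strictly increasing and concave, i.e. $a(j+2)-a(j+1)\le a(j+1)-a(j)$ for all $j\ge 0$. Here $a(j)$ is the probability that an enemy plane is shot down when $j$ missiles are spent on it; if it is not shot down, the fighter survives with probability $u$; enemies arrive according to a Poisson process of rate $1$. Put $c(j)=a(j)+u(1-a(j))$. For $t\ge 0$ (remaining flying time) define inductively on $n$: $N(0,t)=0$; for $r\ge 0$, $N^*(r,t)=e^{-t}\int_0^t N(r,x)e^x\,dx$ (so $N^*(0,t)=0$); for $n\ge 1$ and $1\le j\le n$, $N_n(j,t)=a(j)+c(j)N^*(n-j,t)$; and $N(n,t)=\max_{1\le j\le n}N_n(j,t)$. The optimal spending policy (smallest optimal number of missiles) is, for $n\ge1$, $K(n,t)=\min\{j\in\{1,\dots,n\}: N_n(j,t)=\max_{1\le i\le n}N_n(i,t)\}$. The Invincible Fighter is the case $u=1$, for which $c(j)=1$ and $N_n(j,t)=a(j)+N^*(n-j,t)$. *)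

(* Defs.v *)
From Stdlib Require Import Reals RList List Arith Lia Lra.
From Coquelicot Require Import Coquelicot.
Open Scope R_scope.

(* [a j] is the probability that an enemy is shot down with [j] missiles and
   [u] the probability that the fighter survives an enemy it has missed. *)
Definition c (a : nat -> R) (u : R) (j : nat) : R := a j + u * (1 - a j).

(* [star f t] is the mean of [f (t - X)] over an Exp(1) waiting time [X], where
   [f] counts as 0 beyond the horizon. *)
Definition star (f : R -> R) (t : R) : R :=
  exp (- t) * RInt (fun x => f x * exp x) 0 t.

(* Course-of-values recursion on [n]: for every [n <= m], [Nval_upto a u m n] is
   the value function N(n, .).  See [Nval_0] and [Nval_max]. *)
Fixpoint Nval_upto (a : nat -> R) (u : R) (m n : nat) : R -> R :=
  match m with
  | O => fun _ => 0
  | S m' =>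
      if (n <=? m')%nat then Nval_upto a u m' n
      else fun t =>
        MaxRlist (map (fun j => a j + c a u j * star (Nval_upto a u m' (n - j)) t)
                      (seq 1 n))
  end.

Definition Nval (a : nat -> R) (u : R) (n : nat) : R -> R := Nval_upto a u n n.

Definition Nstar (a : nat -> R) (u : R) (r : nat) (t : R) : R :=
  star (Nval a u r) t.

(* N_n(j, t); used for 1 <= j <= n only. *)
Definition Nspend (a : nat -> R) (u : R) (n j : nat) (t : R) : R :=
  a j + c a u j * Nstar a u (n - j) t.

(* The maximum of N_n(j, t) over 1 <= j <= n. *)
Definition Nmax (a : nat -> R) (u : R) (n : nat) (t : R) : R :=
  MaxRlist (map (fun j => Nspend a u n j t) (seq 1 n)).

(* [find] scans 1, ..., n in increasing order.  The value 0 is only returned for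
   n = 0, where no policy is defined; see [K_spec]. *)
Definition K (a : nat -> R) (u : R) (n : nat) (t : R) : nat :=
  match find (fun j => if Req_EM_T (Nspend a u n j t) (Nmax a u n t)
                       then true else false) (seq 1 n) with
  | Some j => j
  | None => 0%nat
  end.

Lemma Nval_upto_eq a u m n : (n <= m)%nat -> Nval_upto a u m n = Nval a u n.
Proof.
  induction m as [|m IH]; intros Hn.
  - now replace n with 0%nat by lia.
  - destruct (Nat.eq_dec n (S m)) as [->|Hne]; [reflexivity|].
    simpl. replace (n <=? m)%nat with true by (symmetry; apply Nat.leb_le; lia).
    apply IH; lia.
Qed.

Lemma Nval_0 a u t : Nval a u 0 t = 0.
Proof. reflexivity. Qed.

Lemma Nval_max a u n t : (1 <= n)%nat -> Nval a u n t = Nmax a u n t.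
Proof.
  destruct n as [|n]; intros Hn; [lia|].
  unfold Nmax, Nval, Nspend, Nstar; cbn [Nval_upto].
  replace (S n <=? n)%nat with false by (symmetry; apply Nat.leb_gt; lia).
  f_equal; apply map_ext_in; intros j Hj; apply in_seq in Hj.
  now rewrite Nval_upto_eq by lia.
Qed.

Lemma Nmax_ge a u n j t :
  (1 <= j <= n)%nat -> Nspend a u n j t <= Nmax a u n t.
Proof.
  intros Hj; apply MaxRlist_P1, in_map_iff; exists j; split; [easy|].
  apply in_seq; lia.
Qed.

Lemma Nmax_attained a u n t :
  (1 <= n)%nat -> exists j, (1 <= j <= n)%nat /\ Nspend a u n j t = Nmax a u n t.
Proof.
  intros Hn.
  assert (H : In (Nmax a u n t) (map (fun j => Nspend a u n j t) (seq 1 n))).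
  { apply MaxRlist_P2; exists (Nspend a u n 1 t).
    apply in_map_iff; exists 1%nat; split; [easy|]. apply in_seq; lia. }
  apply in_map_iff in H as [j [Ej Hj]]; apply in_seq in Hj.
  exists j; split; [lia|easy].
Qed.

Lemma find_seq_min (p : nat -> bool) (s l j : nat) :
  find p (seq s l) = Some j -> forall i, (s <= i < j)%nat -> p i = false.
Proof.
  revert s; induction l as [|l IH]; intros s; simpl; [discriminate|].
  destruct (p s) eqn:Es.
  - intros E; injection E as <-; intros i Hi; lia.
  - intros E i Hi; destruct (Nat.eq_dec i s) as [->|Hne]; [easy|].
    apply (IH (S s) E); lia.
Qed.

Lemma K_spec a u n t : (1 <= n)%nat ->
  (1 <= K a u n t <= n)%nat /\
  Nspend a u n (K a u n t) t = Nmax a u n t /\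
  (forall j, (1 <= j <= n)%nat -> Nspend a u n j t = Nmax a u n t ->
     (K a u n t <= j)%nat).
Proof.
  intros Hn; unfold K.
  destruct (find _ (seq 1 n)) as [k|] eqn:E.
  - pose proof (find_seq_min _ _ _ _ E) as Hmin.
    apply find_some in E as [Hin Hk]; apply in_seq in Hin; cbv beta in Hk.
    destruct (Req_EM_T (Nspend a u n k t) (Nmax a u n t)) as [Ek|]; [|easy].
    split; [lia|split; [easy|]].
    intros j Hj Ej; destruct (le_lt_dec k j) as [|Hlt]; [easy|].
    specialize (Hmin j ltac:(lia)); cbv beta in Hmin.
    destruct (Req_EM_T (Nspend a u n j t) (Nmax a u n t)); easy.
  - exfalso; destruct (Nmax_attained a u n t Hn) as [j [Hj Ej]].
    pose proof (find_none _ _ E j ltac:(apply in_seq; lia)) as H; cbv beta in H.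
    destruct (Req_EM_T (Nspend a u n j t) (Nmax a u n t)); easy.
Qed.

Lemma continuous_star (f : R -> R) :
  (forall t, continuous f t) -> forall t, continuous (star f) t.
Proof.
  intros Hf t.
  assert (Hc : forall x, continuous (fun x => f x * exp x) x).
  { intros x; apply (continuous_mult f exp); [apply Hf|].
    apply continuity_pt_filterlim, derivable_continuous_pt, derivable_pt_exp. }
  apply (continuous_mult (fun t => exp (- t))).
  - apply (continuous_comp Ropp exp).
    + apply (continuous_opp (fun x : R => x)), continuous_id.
    + apply continuity_pt_filterlim, derivable_continuous_pt, derivable_pt_exp.
  - apply (ex_derive_continuous (fun t => RInt (fun x => f x * exp x) 0 t)).
    exists (f t * exp t); apply (is_derive_RInt (fun x => f x * exp x) _ 0 t).
    + apply filter_forall; intros y.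
      apply (RInt_correct (fun x => f x * exp x)).
      apply (ex_RInt_continuous (fun x => f x * exp x)); auto.
    + apply Hc.
Qed.

Lemma continuous_MaxRlist (F : nat -> R -> R) (l : list nat) t :
  (forall j, In j l -> continuous (F j) t) ->
  continuous (fun t => MaxRlist (map (fun j => F j t) l)) t.
Proof.
  induction l as [|i l IH]; intros H; [apply continuous_const|].
  destruct l as [|i' l]; [apply H; now left|].
  assert (H1 := H i (or_introl eq_refl)).
  assert (H2 := IH (fun j Hj => H j (or_intror Hj))).
  set (G := fun t => MaxRlist (map (fun j => F j t) (i' :: l))) in *.
  apply (continuous_ext (fun t => (F i t + G t + Rabs (F i t - G t)) / 2)).
  { intros x; change (MaxRlist _) with (Rmax (F i x) (G x)).
    unfold Rmax, Rabs; destruct (Rle_dec _ _), (Rcase_abs _); lra. }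
  apply (continuous_mult (fun t => F i t + G t + Rabs (F i t - G t)) (fun _ => / 2));
    [|apply continuous_const].
  apply (continuous_plus (fun t => F i t + G t)).
  - now apply (continuous_plus (F i) G).
  - apply (continuous_comp (fun t => F i t - G t) Rabs).
    + now apply (continuous_minus (F i) G).
    + apply continuous_Rabs.
Qed.

(* Hence the integral in [Nstar] is a genuine Riemann integral. *)
Lemma continuous_Nval a u n t : continuous (Nval a u n) t.
Proof.
  revert t; induction n as [n IH] using lt_wf_ind; intros t.
  destruct n as [|n]; [apply continuous_const|].
  apply (continuous_ext (Nmax a u (S n))).
  { intros x; symmetry; apply Nval_max; lia. }
  apply (continuous_MaxRlist (fun j => Nspend a u (S n) j)).
  intros j Hj; apply in_seq in Hj; unfold Nspend.
  apply (continuous_plus (fun _ => a j) (fun t => c a u j * Nstar a u (S n - j) t));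
    [apply continuous_const|].
  apply (continuous_mult (fun _ => c a u j) (Nstar a u (S n - j)));
    [apply continuous_const|].
  apply continuous_star; intros x; apply IH; lia.
Qed.

(* Main.v *)
(* For [u = 1] the value N(n, .) is, up to a shift, the sup-convolution of the
   sequences [a] and N*(., t).  Sup-convolution and averaging over the waiting
   time both preserve concavity, so by induction N(., t) and N*(., t) are concave
   in the stock; at the origin, where the constraint [1 <= j] matters, this uses
   N*(1, t) <= a 1.  Concavity of N*(., t) then forbids the optimal spending to
   decrease, by exchanging the two optima. *)

Require Import Defs.
From Stdlib Require Import Reals Lra Lia Arith.
From Coquelicot Require Import Coquelicot.
Open Scope R_scope.

(** The bound [M] allows concavity of the value function to be proved by induction on the stock. *)
Definition concave_upto (f : nat -> R) (M : nat) : Prop :=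
  forall k, (S (S k) <= M)%nat -> f (S (S k)) - f (S k) <= f (S k) - f k.

Lemma concave_upto_increment_decr f M p q :
  concave_upto f M -> (p <= q)%nat -> (S q <= M)%nat ->
  f (S q) - f q <= f (S p) - f p.
Proof.
  intros Hf Hpq; induction Hpq as [|q Hpq IH]; intros HM; [lra|].
  specialize (IH ltac:(lia)); specialize (Hf q HM); lra.
Qed.

Lemma concave_upto_exchange f M p q d :
  concave_upto f M -> (p <= q)%nat -> (q + d <= M)%nat ->
  f (q + d)%nat - f q <= f (p + d)%nat - f p.
Proof.
  intros Hf Hpq; induction d as [|d IH]; intros HM.
  - rewrite !Nat.add_0_r; lra.
  - specialize (IH ltac:(lia)); rewrite !Nat.add_succ_r.
    pose proof (concave_upto_increment_decr f M (p + d) (q + d) Hf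
                  ltac:(lia) ltac:(lia)); lra.
Qed.

Lemma ex_RInt_star f t :
  (forall x, continuous f x) -> ex_RInt (fun x => f x * exp x) 0 t.
Proof.
  intros Hf; apply (ex_RInt_continuous (fun x => f x * exp x)); intros x _.
  apply (continuous_mult f exp); [apply Hf | apply continuous_exp].
Qed.

Lemma star_le f g t : 0 <= t ->
  (forall x, continuous f x) -> (forall x, continuous g x) ->
  (forall x, 0 <= x <= t -> f x <= g x) -> star f t <= star g t.
Proof.
  intros Ht Cf Cg Hfg; unfold star.
  apply Rmult_le_compat_l; [left; apply exp_pos|].
  apply RInt_le; [easy | now apply ex_RInt_star | now apply ex_RInt_star |].
  intros x Hx; apply Rmult_le_compat_r; [left; apply exp_pos|].
  apply Hfg; lra.
Qed.

Lemma star_plus f g t :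
  (forall x, continuous f x) -> (forall x, continuous g x) ->
  star (fun x => f x + g x) t = star f t + star g t.
Proof.
  intros Cf Cg; unfold star; rewrite <- Rmult_plus_distr_l; f_equal.
  apply is_RInt_unique.
  apply (is_RInt_ext (fun x => plus (f x * exp x) (g x * exp x))).
  { intros x _; unfold plus; simpl; ring. }
  apply (is_RInt_plus (fun x => f x * exp x) (fun x => g x * exp x));
    apply (RInt_correct (fun x => _ x * exp x)); now apply ex_RInt_star.
Qed.

Lemma star_const k t : star (fun _ => k) t = k * (1 - exp (- t)).
Proof.
  unfold star.
  replace (RInt (fun x => k * exp x) 0 t) with (k * exp t - k * exp 0).
  { rewrite exp_0, exp_Ropp; field; apply Rgt_not_eq, exp_pos. }
  symmetry; apply is_RInt_unique.
  apply (is_RInt_derive (fun x => k * exp x) (fun x => k * exp x)); intros x _.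
  - auto_derive; [easy | ring].
  - apply (continuous_mult (fun _ => k) exp);
      [apply continuous_const | apply continuous_exp].
Qed.

(** Comparison with the constant [k], whose mean is [k] times the probability [1 - exp (- t)] of an
    arrival before the horizon. *)
Lemma star_le_bound f k t : 0 <= t -> 0 <= k ->
  (forall x, continuous f x) -> (forall x, 0 <= x <= t -> f x <= k) ->
  star f t <= k.
Proof.
  intros Ht Hk Cf Hf.
  assert (H : star f t <= star (fun _ => k) t).
  { apply star_le; trivial; intros x; apply continuous_const. }
  rewrite star_const in H; pose proof (exp_pos (- t)); nra.
Qed.

(** [star] is additive and monotone, so it preserves the inequality once this is written with sums
    only. *)
Lemma Nstar_concave a u M t : 0 <= t ->
  (forall x, 0 <= x <= t -> concave_upto (fun r => Nval a u r x) M) ->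
  concave_upto (fun r => Nstar a u r t) M.
Proof.
  intros Ht H k Hk; unfold Nstar.
  pose proof (continuous_Nval a u) as C.
  assert (L : star (fun x => Nval a u (S (S k)) x + Nval a u k x) t
              <= star (fun x => Nval a u (S k) x + Nval a u (S k) x) t).
  { apply star_le; [easy | | |].
    - intros x; apply (continuous_plus (Nval a u (S (S k)))); apply C.
    - intros x; apply (continuous_plus (Nval a u (S k))); apply C.
    - intros x Hx; specialize (H x Hx k Hk); cbv beta in H; lra. }
  rewrite !star_plus in L by (intros x; apply C); lra.
Qed.

Lemma Nspend_invincible a n j t :
  Nspend a 1 n j t = a j + Nstar a 1 (n - j) t.
Proof. unfold Nspend, c; ring. Qed.

Lemma Nmax_one_invincible a t : Nmax a 1 1 t = a 1%nat.
Proof.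
  change (Nspend a 1 1 1 t = a 1%nat).
  rewrite Nspend_invincible; unfold Nstar; simpl Nat.sub.
  change (Nval a 1 0) with (fun _ : R => 0); rewrite star_const; ring.
Qed.

(** Optimal spendings [i] for stock [n] and [j] for stock [n + 2] yield two admissible spendings for
    stock [n + 1], whose values add up to at least as much. *)
Lemma Nmax_step_concave a n t :
  (forall M, concave_upto a M) -> concave_upto (fun r => Nstar a 1 r t) (S n) ->
  (1 <= n)%nat ->
  Nmax a 1 (S (S n)) t - Nmax a 1 (S n) t <= Nmax a 1 (S n) t - Nmax a 1 n t.
Proof.
  intros Ha HB Hn.
  destruct (Nmax_attained a 1 n t Hn) as [i [Hi Ei]].
  destruct (Nmax_attained a 1 (S (S n)) t ltac:(lia)) as [j [Hj Ej]].
  rewrite Nspend_invincible in Ei, Ej.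
  destruct (le_lt_dec j i) as [Hji|Hij].
  (* Keep both spendings and move one missile between the reserves: concavity of N*. *)
  - pose proof (Nmax_ge a 1 (S n) i t ltac:(lia)) as Gi.
    pose proof (Nmax_ge a 1 (S n) j t ltac:(lia)) as Gj.
    rewrite Nspend_invincible in Gi, Gj.
    pose proof (concave_upto_increment_decr _ _ (n - i) (S n - j) HB
                  ltac:(lia) ltac:(lia)) as D; cbv beta in D.
    replace (S (n - i)) with (S n - i)%nat in D by lia.
    replace (S (S n - j)) with (S (S n) - j)%nat in D by lia.
    lra.
  (* Keep both reserves and spend [i + 1] and [j - 1] instead: concavity of [a]. *)
  - destruct j as [|j]; [lia|].
    pose proof (Nmax_ge a 1 (S n) (S i) t ltac:(lia)) as Gi.
    pose proof (Nmax_ge a 1 (S n) j t ltac:(lia)) as Gj.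
    rewrite Nspend_invincible in Gi, Gj.
    pose proof (concave_upto_increment_decr _ _ i j (Ha (S j))
                  ltac:(lia) ltac:(lia)) as D.
    simpl Nat.sub in Gi, Gj, Ej; lra.
Qed.

Lemma Nval_concave a : a 0%nat = 0 -> 0 <= a 1%nat ->
  (forall M, concave_upto a M) ->
  forall M t, 0 <= t -> concave_upto (fun r => Nval a 1 r t) M.
Proof.
  intros a_0 a_1 Ha; induction M as [|M IH]; intros t Ht k Hk; [lia|].
  destruct (le_lt_dec (S (S k)) M) as [Hle|Hlt]; [now apply (IH t Ht k)|].
  destruct k as [|k].
  (* At the origin the claim is N(2, t) <= 2 [a 1], checked for each of the two possible
     spendings. *)
  - rewrite Nval_0, !Nval_max, Nmax_one_invincible by lia.
    destruct (Nmax_attained a 1 2 t ltac:(lia)) as [j [Hj Ej]].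
    rewrite Nspend_invincible in Ej; rewrite <- Ej.
    destruct j as [|[|[|j]]]; [lia | | | lia]; simpl Nat.sub; unfold Nstar.
    + enough (star (Nval a 1 1) t <= a 1%nat) by lra.
      apply star_le_bound; [easy | easy | apply continuous_Nval|].
      intros x _; rewrite Nval_max, Nmax_one_invincible by lia; lra.
    + change (Nval a 1 0) with (fun _ : R => 0); rewrite star_const.
      pose proof (Ha 2%nat 0%nat ltac:(lia)); lra.
  - rewrite !Nval_max by lia.
    apply Nmax_step_concave; [easy | | lia].
    (* At least one missile is spent, so only reserves up to [M] occur and the induction hypothesis
       suffices. *)
    replace (S (S k)) with M by lia.
    apply Nstar_concave; [easy|]; intros x Hx; apply IH; lra.
Qed.

Theorem theorem4p2 (a : nat -> R)
  (a_prob : forall j : nat, 0 <= a j <= 1)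
  (a_0 : a 0%nat = 0)
  (a_incr : forall j : nat, a j < a (S j))
  (a_concave : forall j : nat, a (S (S j)) - a (S j) <= a (S j) - a j) :
  forall t : R, 0 <= t ->
  forall m n : nat, (1 <= m)%nat -> (m <= n)%nat ->
  (K a 1 m t <= K a 1 n t)%nat.
Proof.
  intros t Ht m n Hm Hmn.
  destruct (K_spec a 1 m t Hm) as [Hk [Ek Mk]].
  destruct (K_spec a 1 n t ltac:(lia)) as [Hl [El _]].
  set (k := K a 1 m t) in *; set (l := K a 1 n t) in *.
  destruct (le_lt_dec k l) as [|Hlk]; [easy|exfalso].
  (* Strict, because [k] is the smallest optimum for [m] and [l < k]. *)
  assert (Hlt : Nspend a 1 m l t < Nspend a 1 m k t).
  { pose proof (Nmax_ge a 1 m l t ltac:(lia)) as Hle.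
    destruct (Req_dec (Nspend a 1 m l t) (Nmax a 1 m t)) as [E|]; [|lra].
    specialize (Mk l ltac:(lia) E); lia. }
  pose proof (Nmax_ge a 1 n k t ltac:(lia)) as Hge; rewrite <- El in Hge.
  rewrite !Nspend_invincible in Hlt, Hge.
  assert (HB : concave_upto (fun r => Nstar a 1 r t) n).
  { apply Nstar_concave; [easy|]; intros x Hx.
    apply Nval_concave; [easy | apply a_prob | intros M i _; apply a_concave | lra]. }
  (* Saving [k - l] missiles gains less than [a k - a l] at stock [m] but at least that much at
     stock [n], whereas by concavity the gain cannot grow with the stock. *)
  pose proof (concave_upto_exchange _ _ (m - k) (n - k) (k - l) HB
                ltac:(lia) ltac:(lia)) as D; cbv beta in D.
  replace (n - k + (k - l))%nat with (n - l)%nat in D by lia.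
  replace (m - k + (k - l))%nat with (m - l)%nat in D by lia.
  lra.
Qed.
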